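(* Every boolean function $f:B^3\to B$ that depends on all three of its variables is convenient.
   Context: $B=\{0,1\}$. A transient is a nonempty word $\mathbf{t}=t_1\cdots t_m$ over $B$ with consecutive letters different; $\alpha(\mathbf{t})=t_1$, $\omega(\mathbf{t})=t_m$, $\Delta(\mathbf{t})=m-1$; the contraction of a nonempty binary word deletes every letter equal to its predecessor. A transient vector $\mathbf{x}=(\mathbf{x}_1,\ldots,\mathbf{x}_n)$ has $\Delta(\mathbf{x})=\sum_i\Delta(\mathbf{x}_i)$; it is proper if every $\Delta(\mathbf{x}_i)\ge1$. For proper $\mathbf{t}=t_1\cdots t_m$ the characteristic transient is $\tilde{\mathbf{t}}=t_1t_2$ if $m$ is even and $t_1t_2t_3$ if $m$ is odd; $\tilde{\mathbf{x}}$ is taken componentwise. Extension: for $f:B^n\to B$, $D_f(\mathbf{x})$ has as vertices the vectors of nonempty prefixes of the components of $\mathbf{x}$, with arcs appending one letter to exactly one component, and vertex label $\lambda(\mathbf{v})=f(\omega(\mathbf{v}))$ ($\omega$ componentwise). $\mathbf{f}(\mathbf{x})$ is the longest contraction of $\lambda(\mathbf{v}^1)\cdots\lambda(\mathbf{v}^r)$ over directed paths $\mathbf{v}^1,\ldots,\mathbf{v}^r$ from the vector of first letters of $\mathbf{x}$ to $\mathbf{x}$. Cost: $c_f(\mathbf{x})=\Delta(\mathbf{x})-\Delta(\mathbf{f}(\mathbf{x}))$. $f$ depends on its $k$-th argument if changing only $x_k$ changes the value of $f$ for some assignment. $f$ is convenient if it depends on all its variables and $c_f(\mathbf{x})=c_f(\tilde{\mathbf{x}})$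 for every proper transient vector $\mathbf{x}$. *)

(* Defs.v *)
From Stdlib Require Import ClassicalEpsilon.
From mathcomp Require Import all_boot all_order all_algebra zify.

Set Implicit Arguments.
Unset Strict Implicit.
Unset Printing Implicit Defensive.

Definition word := seq bool.
Definition alternating : word -> bool := sorted (fun a b : bool => a != b).
Definition transient (t : word) : bool := (t != [::]) && alternating t.

(* [head] and [last] need a default letter; [false] is never reached on the
   nonempty words used below. *)
Definition alpha (t : word) : bool := head false t.
Definition omega (t : word) : bool := last false t.
Definition Delta (t : word) : nat := (size t).-1.

(* [pairmap] compares each letter with its predecessor in the uncontracted
   word. *)
Definition contraction (w : word) : word :=
  if w is a :: s then a :: mask (pairmap (fun p c : bool => c != p) a s) s
  else [::].

(* A transient of length 1 is not proper; [ctrans] leaves it unchanged. *)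
Definition ctrans (t : word) : word := take (if odd (size t) then 3 else 2) t.

Definition bvec (n : nat) := {ffun 'I_n -> bool}.
Definition wvec (n : nat) := {ffun 'I_n -> word}.

Definition omegav n (x : wvec n) : bvec n := [ffun i => omega (x i)].
Definition Deltav n (x : wvec n) : nat := \sum_(i < n) Delta (x i).
Definition transientv n (x : wvec n) : bool := [forall i, transient (x i)].
Definition proper n (x : wvec n) : bool :=
  transientv x && [forall i, 1 <= Delta (x i)].
Definition ctransv n (x : wvec n) : wvec n := [ffun i => ctrans (x i)].

Definition vertex n (x v : wvec n) : bool :=
  [forall i, (v i != [::]) && prefix (v i) (x i)].
Definition append n (v : wvec n) (k : 'I_n) (b : bool) : wvec n :=
  [ffun i => if i == k then rcons (v i) b else v i].
Definition arc n (x : wvec n) : rel (wvec n) := fun v w =>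
  [&& vertex x v, vertex x w & [exists k, exists b, w == append v k b]].
Definition source n (x : wvec n) : wvec n := [ffun i => [:: alpha (x i)]].

(* [p] lists the vertices of the path that come after [source x]. *)
Definition dpath n (x : wvec n) (p : seq (wvec n)) : bool :=
  path (arc x) (source x) p && (last (source x) p == x).

Definition label n (f : bvec n -> bool) (v : wvec n) : bool := f (omegav v).
Definition path_word n (f : bvec n -> bool) (x : wvec n) (p : seq (wvec n)) :
  word := contraction (map (label f) (source x :: p)).

Definition longest_contraction n (f : bvec n -> bool) (x : wvec n) (t : word) :
  Prop :=
  (exists2 p, dpath x p & t = path_word f x p) /\
  (forall p, dpath x p -> size (path_word f x p) <= size t).

(* Existence and uniqueness of the described word, whenever all components
   of [x] are nonempty, are [extP] and [longest_contraction_uniq]. *)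
Definition ext n (f : bvec n -> bool) (x : wvec n) : word :=
  epsilon (inhabits [::]) (longest_contraction f x).

Definition cost n (f : bvec n -> bool) (x : wvec n) : int :=
  ((Deltav x)%:Z - (Delta (ext f x))%:Z)%R.

Definition depends_on n (f : bvec n -> bool) (k : 'I_n) : Prop :=
  exists a b : bvec n, (forall j, j != k -> a j = b j) /\ f a <> f b.

Definition depends_on_all n (f : bvec n -> bool) : Prop :=
  forall k, depends_on f k.

Definition convenient n (f : bvec n -> bool) : Prop :=
  depends_on_all f /\ forall x, proper x -> cost f x = cost f (ctransv x).

Lemma contraction_transient w : w != [::] -> transient (contraction w).
Proof.
case: w => // a s _; rewrite /transient /alternating /=.
elim: s a => //= c s IH a; case: (eqVneq c a) => [<-|ne] /=; first exact: IH.
by rewrite eq_sym ne IH.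
Qed.

Lemma size_contraction w : size (contraction w) <= size w.
Proof.
case: w => //= a s; rewrite ltnS size_mask ?size_pairmap //.
by rewrite (leq_trans (count_size _ _)) ?size_pairmap.
Qed.

Lemma ctrans_transient t : transient t -> transient (ctrans t).
Proof.
case/andP=> tN0 tA; apply/andP; split; last exact: take_sorted.
by case: t tN0 {tA} => // a t _; rewrite /ctrans; case: ifP.
Qed.

Lemma alternating_inj s t :
  alternating s -> alternating t -> size s = size t ->
  head false s = head false t -> s = t.
Proof.
case: s t => [|a s] [|b t] //= + + [sz] eab; subst b.
rewrite /alternating /=; move: sz.
elim: s t a => [|c s IH] [|d t] //= a [sz] /andP[ac cs] /andP[ad dt].
have cd : c = d by move: ac ad; case: (a); case: (c); case: (d).
by subst d; case: (IH t c sz cs dt) => <-.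
Qed.

Lemma longest_contraction_uniq n (f : bvec n -> bool) (x : wvec n) s t :
  longest_contraction f x s -> longest_contraction f x t -> s = t.
Proof.
move=> [[p px ->] maxp] [[q qx ->] maxq].
have tr r : transient (path_word f x r) by exact: contraction_transient.
apply: alternating_inj => //; first by case/andP: (tr p).
  by case/andP: (tr q).
by apply/eqP; rewrite eqn_leq maxp // maxq.
Qed.

Lemma vertex_refl n (x : wvec n) : (forall i, x i != [::]) -> vertex x x.
Proof. by move=> xN0; apply/forallP=> i; rewrite xN0 prefix_refl. Qed.

Lemma dpath_exists n (x : wvec n) :
  (forall i, x i != [::]) -> exists p, dpath x p.
Proof.
move: {2}(Deltav x) (erefl (Deltav x)) => m.
elim: m x => [|m IH] x Dx xN0.
  exists [::]; rewrite /dpath /=; apply/eqP/ffunP=> i; rewrite ffunE.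
  have /eqP := Dx; rewrite sum_nat_eq0 => /forallP/(_ i).
  by rewrite /Delta /alpha; move: (xN0 i); case: (x i) => [|a []].
have [k Dk] : exists k, 0 < Delta (x k).
  apply/existsP; apply: contra_eqT Dx; rewrite negb_exists => /forallP D0.
  rewrite /Deltav big1 // => i _; apply/eqP.
  by move: (D0 i); rewrite -eqn0Ngt.
have [s [b xk]] : exists s b, x k = rcons s b.
  by case: (lastP (x k)) (xN0 k) => // s b _; exists s, b.
have sN0 : s != [::] by move: Dk; rewrite xk; case: (s).
pose y : wvec n := [ffun i => if i == k then s else x i].
have yN0 i : y i != [::] by rewrite ffunE; case: ifP.
have xE : x = append y k b.
  by apply/ffunP=> i; rewrite !ffunE; case: eqP => // ->.
have pre i : prefix (y i) (x i).
  by rewrite ffunE; case: eqP => [->|_]; rewrite ?xk ?prefix_rcons ?prefix_refl.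
have Dy : Deltav y = m.
  apply/eqP; rewrite -eqSS -Dx /Deltav (bigD1 k) //= [X in _ == X](bigD1 k) //=.
  rewrite -addSn; apply/eqP; congr (_ + _).
    by rewrite ffunE eqxx xk /Delta size_rcons /=; case: (s) sN0.
  by apply: eq_bigr => i /negPf ik; rewrite ffunE ik.
have [p /andP[pp /eqP lp]] := IH y Dy yN0.
have sxy : source y = source x.
  apply/ffunP=> i; rewrite !ffunE; case: eqP => // ->; rewrite xk.
  by case: (s) sN0.
have vV v : vertex y v -> vertex x v.
  move=> /forallP vy; apply/forallP=> i; case/andP: (vy i) => -> h /=.
  exact: prefix_trans h (pre i).
exists (rcons p x); rewrite /dpath last_rcons eqxx andbT rcons_path -sxy lp.
apply/andP; split.
  apply: sub_path pp => v w /and3P[vv vw h].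
  by rewrite /arc (vV _ vv) (vV _ vw).
rewrite /arc (vV _ (vertex_refl yN0)) vertex_refl //=.
by apply/existsP; exists k; apply/existsP; exists b; rewrite -xE.
Qed.

Lemma size_dpath_bound n (x : wvec n) p : dpath x p -> size p <= Deltav x.
Proof.
case/andP=> pp /eqP lp; rewrite -[X in Deltav X]lp {lp}.
suff H v : path (arc x) v p -> size p + Deltav v <= Deltav (last v p).
  by apply: leq_trans (H _ pp); rewrite leq_addr.
elim: p v {pp} => //= w p IH v /andP[/and3P[/forallP vv _ /existsP[k /existsP[b /eqP wE]]] pp].
apply: leq_trans (IH _ pp); rewrite addSnnS leq_add2l wE /Deltav.
rewrite (bigD1 k) //= [X in _ <= X](bigD1 k) //= -addSn leq_add //.
  rewrite ffunE eqxx /Delta size_rcons /=.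
  by case/andP: (vv k); case: (v k).
by apply: leq_sum => i /negPf ik; rewrite ffunE ik.
Qed.

Lemma extP n (f : bvec n -> bool) (x : wvec n) :
  (forall i, x i != [::]) -> longest_contraction f x (ext f x).
Proof.
move=> xN0; apply: epsilon_spec; have [p0 p0x] := dpath_exists xN0.
have bnd p : dpath x p -> size (path_word f x p) <= (Deltav x).+1.
  move=> /size_dpath_bound px; apply: leq_trans (size_contraction _) _.
  by rewrite size_map.
move: {2}((Deltav x).+1 - _) (leqnn ((Deltav x).+1 - size (path_word f x p0))) => m.
elim: m p0 p0x => [|m IH] p px le.
  exists (path_word f x p); split; first by exists p.
  by move=> q /bnd; lia.
case: (classic (exists2 q, dpath x q & size (path_word f x p) < size (path_word f x q))).
  by move=> [q qx lt]; apply: (IH q qx); have := bnd q qx; lia.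
move=> no; exists (path_word f x p); split; first by exists p.
by move=> q qx; rewrite leqNgt; apply/negP=> lt; apply: no; exists q.
Qed.

(* Main.v *)
(** A directed path from the source to [x] is a lattice path, the label at
    displacement [d] depends only on the parities of [d], and the cost is the
    least number of steps that do not change the label.  This minimum is a
    shortest-path distance, so it is certified by a potential [V].  For three
    variables, take [V d] to depend only on the classes of the [d i] in
    0, 1, {2, 4, ...}, {3, 5, ...}.  The shortest-path distances in the finite
    quotient graph bound the cost from below.  They are attained on a set [E]
    of classes containing all the interior ones (all components positive): for
    each class in [E] there is a direction such that stepping back in it, to
    whichever class the predecessor belongs, stays in [E] and is optimal.  On
    interior classes the distances depend only on parities.  For every truth
    table with three essential variables this is a finite check. *)

Require Import Defs.
From mathcomp Require Import all_boot all_algebra zify.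

Set Implicit Arguments.
Unset Strict Implicit.
Unset Printing Implicit Defensive.

(** * Lattice paths and lazy steps, for any number of variables *)

Section LatticePaths.

Variables (n : nat) (f : bvec n -> bool).

Implicit Types (x v w : wvec n) (p : seq (wvec n)).

Fixpoint lazy_count (v : wvec n) (p : seq (wvec n)) : nat :=
  if p is w :: q then (label f v == label f w) + lazy_count w q else 0.

Lemma lazy_count_rcons v p w :
  lazy_count v (rcons p w) =
  lazy_count v p + (label f (last v p) == label f w).
Proof. by elim: p v => [|u p IH] v /=; rewrite ?addn0 // IH addnA. Qed.

(** Contraction drops exactly the letters produced by lazy steps, so every step of the path is
    counted once on the left. *)
Lemma Delta_path_word x p :
  Delta (path_word f x p) + lazy_count (source x) p = size p.
Proof.
rewrite /path_word /Delta /=; elim: p (source x) => //= w p IH v.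
by have := IH w; rewrite [label f v == _]eq_sym; case: eqP => _ /=; lia.
Qed.

Definition position := {ffun 'I_n -> nat}.

Implicit Types d e : position.

Definition step d (k : 'I_n) : position :=
  [ffun i => d i + (i == k)].

Lemma sum_step d k : \sum_i step d k i = (\sum_i d i).+1.
Proof.
rewrite (bigD1 k) //= [in RHS](bigD1 k) //= ffunE eqxx addn1 addSn.
by congr (_ + _).+1; apply: eq_bigr => i /negPf ik; rewrite ffunE ik addn0.
Qed.

Definition displacement (v : wvec n) : position := [ffun i => Delta (v i)].

Definition position_label (x : wvec n) (d : position) : bool :=
  f [ffun i => alpha (x i) (+) odd (d i)].

Definition vertex_at (x : wvec n) (d : position) : wvec n :=
  [ffun i => take (d i).+1 (x i)].

Lemma transient_neq0 x : transientv x -> forall i, x i != [::].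
Proof. by move=> /forallP xT i; case/andP: (xT i). Qed.

Lemma omega_alternating a (s : word) :
  alternating (a :: s) -> omega (a :: s) = a (+) odd (size s).
Proof.
rewrite /alternating /omega /=; elim: s a => [|b s IH] a /=; first by rewrite addbF.
by case/andP=> ab /IH ->; move: ab; case: a; case: b; case: odd.
Qed.

Lemma label_vertex x v :
  transientv x -> vertex x v -> label f v = position_label x (displacement v).
Proof.
move=> /forallP xT /forallP xv; congr f; apply/ffunP=> i; rewrite !ffunE.
case/andP: (xT i) => _ xA; case/andP: (xv i) => vN0 /prefixP[s xE].
move: xA; rewrite xE /alternating => /cat_sorted2[vA _].
by case: (v i) vN0 vA => // a t _ /omega_alternating ->.
Qed.

Lemma displacement_append x v k b :
  vertex x v -> displacement (append v k b) = step (displacement v) k.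
Proof.
move=> /forallP/(_ k)/andP[vN0 _]; apply/ffunP=> i; rewrite !ffunE.
case: eqP => [->|_]; rewrite ?addn0 // /Delta size_rcons /= addn1.
by case: (v k) vN0.
Qed.

Lemma vertex_vertex_at x d :
  transientv x -> vertex x (vertex_at x d).
Proof.
move=> /transient_neq0 xN0; apply/forallP=> i; rewrite ffunE prefix_take andbT.
by case: (x i) (xN0 i).
Qed.

Lemma vertex_at_displacement x :
  transientv x -> vertex_at x (displacement x) = x.
Proof.
move=> /transient_neq0 xN0; apply/ffunP=> i; rewrite !ffunE /Delta take_oversize //.
by case: (x i) (xN0 i).
Qed.

Lemma displacement_vertex_at x d :
  (forall i, d i <= Delta (x i)) -> transientv x -> displacement (vertex_at x d) = d.
Proof.
move=> dx /transient_neq0 xN0; apply/ffunP=> i; rewrite !ffunE.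
move: (dx i) (xN0 i); rewrite /Delta size_take_min; case: (x i) => //= a s; lia.
Qed.

Lemma arc_vertex_at x d k : transientv x ->
  d k < Delta (x k) -> Defs.arc x (vertex_at x d) (vertex_at x (step d k)).
Proof.
move=> xT dk; rewrite /Defs.arc !vertex_vertex_at //=.
apply/existsP; exists k; apply/existsP; exists (nth false (x k) (d k).+1).
apply/eqP/ffunP=> i; rewrite !ffunE; case: eqP => [->|_]; last by rewrite addn0.
by rewrite addn1 -take_nth //; move: dk; rewrite /Delta; lia.
Qed.

Definition lazy_step x (d e : position) : bool :=
  position_label x d == position_label x e.

(** Telescoping: along a path [V] grows by at most one at a lazy step and does not grow at any
    other. *)
Lemma dpath_lazy_count_ge x (V : position -> nat) p :
  transientv x -> V [ffun=> 0] = 0 ->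
  (forall d k, V (step d k) <= V d + lazy_step x d (step d k)) ->
  dpath x p -> V (displacement x) <= lazy_count (source x) p.
Proof.
move=> xT V0 Vstep /andP[pP /eqP lastp].
rewrite -[X in displacement X]lastp.
have V1 : V (displacement (source x)) = 0.
  by rewrite -[RHS]V0; congr V; apply/ffunP=> i; rewrite !ffunE.
rewrite -[leqRHS]add0n -V1; elim: p (source x) pP {lastp V1} => [|w p IH] v /=.
  by rewrite addn0.
case/andP=> /and3P[xv xw /existsP[k /existsP[b /eqP wE]]] /IH le.
apply: leq_trans le _; rewrite addnA leq_add2r !(label_vertex xT) //.
by rewrite wE (displacement_append _ _ xv) Vstep.
Qed.

(** A cheap path is traced backwards: each position of [E] other than the origin has a predecessor
    in [E] whose [V] leaves room for the step, and the coordinate sum drops until the origin is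
    reached. *)
Lemma dpath_lazy_count_le x (V : position -> nat) (E : pred position) :
  transientv x ->
  (forall d, E d -> d = [ffun=> 0] \/ exists k e,
     [/\ d = step e k, E e & V e + lazy_step x e d <= V d]) ->
  E (displacement x) ->
  exists2 p, dpath x p & lazy_count (source x) p <= V (displacement x).
Proof.
move=> xT attainedV Ex.
(* Within the bounds [d i <= Delta (x i)] the position can be recovered from [vertex_at x d], so
   labels can be read off positions. *)
suff H m (d : position) :
    \sum_i d i < m -> (forall i, d i <= Delta (x i)) -> E d ->
    exists p, [/\ path (Defs.arc x) (source x) p,
                  last (source x) p = vertex_at x d &
                  lazy_count (source x) p <= V d].
  have [|p [pP lastp le]] := H _ _ (ltnSn _) _ Ex; first by move=> i; rewrite ffunE.
  by exists p => //; rewrite /dpath pP lastp vertex_at_displacement /=.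
elim: m d => // m IH d dm dx Ed; case: (attainedV d Ed) => [d0|[k [e [dE Ee le]]]].
  exists [::]; split=> //=; apply/ffunP=> i; rewrite d0 !ffunE.
  by case: (x i) (transient_neq0 xT i) => //= a s _; rewrite take0.
have ex i : e i <= Delta (x i).
  by apply: leq_trans (dx i); rewrite dE ffunE leq_addr.
have ek : e k < Delta (x k).
  by apply: leq_trans (dx k); rewrite dE ffunE eqxx addn1.
have em : \sum_i e i < m.
  by move: dm; rewrite dE sum_step.
have [p [pP lastp lep]] := IH e em ex Ee.
exists (rcons p (vertex_at x d)); rewrite last_rcons rcons_path pP lastp /=; split=> //.
  by rewrite dE arc_vertex_at.
rewrite lazy_count_rcons lastp !(label_vertex xT) ?vertex_vertex_at //.
rewrite !displacement_vertex_at //; apply: leq_trans le.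
by rewrite leq_add2r.
Qed.

Lemma size_dpath x p : dpath x p -> size p = Deltav x.
Proof.
case/andP=> pP /eqP lastp; rewrite -[in RHS]lastp.
have src0 : Deltav (source x) = 0 by rewrite /Deltav big1 // => i _; rewrite ffunE.
rewrite -[LHS]addn0 -src0; elim: p (source x) pP {lastp src0} => //= w p IH v.
case/andP=> /and3P[xv xw /existsP[k /existsP[b /eqP wE]]] /IH <-.
suff -> : Deltav w = (Deltav v).+1 by rewrite addnS.
have dE u : Deltav u = \sum_i displacement u i.
  by apply: eq_bigr => i _; rewrite ffunE.
by rewrite !dE wE (displacement_append _ _ xv) sum_step.
Qed.

(** All directed paths have [Deltav x] steps, so a longest contraction comes from a path with fewest
    lazy steps, and the cost is their number. *)
Lemma cost_min_lazy_count x m : transientv x ->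
  (forall p, dpath x p -> m <= lazy_count (source x) p) ->
  (exists2 p, dpath x p & lazy_count (source x) p <= m) ->
  cost f x = m%:Z%R.
Proof.
move=> xT ge [p px le].
have [[q qx extE] maxq] := extP f (transient_neq0 xT).
have := maxq p px; have := ge q qx; have := ge p px.
have := Delta_path_word x p; have := Delta_path_word x q.
rewrite /cost extE (size_dpath px) (size_dpath qx) /Delta.
have szN0 r : 0 < size (path_word f x r) by [].
have := szN0 p; have := szN0 q; lia.
Qed.

Lemma cost_potential x (V : position -> nat) (E : pred position) :
  transientv x -> V [ffun=> 0] = 0 ->
  (forall d k, V (step d k) <= V d + lazy_step x d (step d k)) ->
  (forall d, E d -> d = [ffun=> 0] \/ exists k e,
     [/\ d = step e k, E e & V e + lazy_step x e d <= V d]) ->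
  E (displacement x) -> cost f x = (V (displacement x))%:Z%R.
Proof.
move=> xT V0 Vstep attainedV Ex; apply: cost_min_lazy_count => //.
  by move=> p; apply: dpath_lazy_count_ge.
exact: dpath_lazy_count_le attainedV Ex.
Qed.

End LatticePaths.

(** * The quotient graph for three variables *)

Definition state := (nat * nat * nat)%type.

Definition sat_succ s := if s is 3 then 2 else s.+1.

(* [sat m] is [m] for [m <= 3]; larger numbers go to 2 or 3 by parity. *)
Definition sat m := iter m sat_succ 0.

(** Class 2 has two predecessors: 2 follows 1, while 4, 6, ... follow members of class 3. *)
Definition sat_pred s :=
  match s with 1 => [:: 0] | 2 => [:: 1; 3] | 3 => [:: 2] | _ => [::] end.

Definition states : seq state :=
  [seq (ab, c) | ab <- [seq (a, b) | a <- iota 0 4, b <- iota 0 4],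
                 c <- iota 0 4].

(* One list per direction, with all classes from which one step in that direction
   may lead to [s]. *)
Definition state_preds (s : state) : seq (seq state) :=
  let: (a, b, c) := s in
  [:: [seq (t, b, c) | t <- sat_pred a]; [seq (a, t, c) | t <- sat_pred b];
      [seq (a, b, t) | t <- sat_pred c]].

Definition state_label (g : bool -> bool -> bool -> bool) (s : state) : bool :=
  let: (a, b, c) := s in g (odd a) (odd b) (odd c).

Definition state_lazy g s t : bool := state_label g t == state_label g s.

(* An empty list is a direction in which no step back is possible. *)
Definition attained g (V : state -> nat) (E : pred state) (s : state) : bool :=
  (s == (0, 0, 0)) ||
  has (fun l => (l != [::]) &&
         all (fun t => E t && (V t + state_lazy g t s <= V s)) l)
    (state_preds s).

(* The displacement of [ctrans t], when [s] is the class of that of [t]. *)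
Definition reduce s := if odd s then 1 else 2.

(** The first three clauses are the hypotheses of [cost_potential] read on classes; the last
    compares a proper vector with its characteristic one. *)
Definition certificate g (V : state -> nat) (E : pred state) : bool :=
  [&& V (0, 0, 0) == 0,
      all (fun s => all (fun t => V s <= V t + state_lazy g t s)
                      (flatten (state_preds s))) states,
      all (fun s => E s ==> attained g V E s) states &
      all (fun s : state => let: (a, b, c) := s in
             [&& 0 < a, 0 < b & 0 < c] ==>
             E s && (V s == V (reduce a, reduce b, reduce c))) states].

(* Memoization: the table is computed once, before any state is looked up. *)
Definition tabulate T (x : T) (F : state -> T) : state -> T :=
  let table :=
    [seq [seq [seq F (a, b, c) | c <- iota 0 4] | b <- iota 0 4]
       | a <- iota 0 4] in
  fun s => let: (a, b, c) := s in nth x (nth [::] (nth [::] table a) b) c.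

(* Bellman-Ford relaxation: 9 bounds the distances, since every state is within
   9 steps of the origin. *)
Definition min_lazy g : state -> nat :=
  iter 9 (fun V => tabulate 0 (fun s =>
            foldr minn (V s)
              [seq V t + state_lazy g t s | t <- flatten (state_preds s)]))
    (fun s => if s == (0, 0, 0) then 0 else 9).

(* Iterates down to a greatest fixed point; [certificate] checks that 7 rounds
   suffice. *)
Definition attained_states g (V : state -> nat) : pred state :=
  iter 7 (fun E => tabulate false (attained g V E)) xpredT.

(** * The finite check over all truth tables *)

Definition all_bool (P : pred bool) := P false && P true.
Definition has_bool (P : pred bool) := P false || P true.

Definition essential (g : bool -> bool -> bool -> bool) : bool :=
  [&& has_bool (fun b => has_bool (fun c => g false b c != g true b c)),
      has_bool (fun a => has_bool (fun c => g a false c != g a true c)) &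
      has_bool (fun a => has_bool (fun b => g a b false != g a b true))].

Definition truth_table b0 b1 b2 b3 b4 b5 b6 b7 (a b c : bool) : bool :=
  if a then if b then if c then b7 else b6 else if c then b5 else b4
  else if b then if c then b3 else b2 else if c then b1 else b0.

Definition all_truth_tables (P : pred (bool -> bool -> bool -> bool)) : bool :=
  all_bool (fun b0 => all_bool (fun b1 => all_bool (fun b2 => all_bool (fun b3 =>
  all_bool (fun b4 => all_bool (fun b5 => all_bool (fun b6 => all_bool (fun b7 =>
    P (truth_table b0 b1 b2 b3 b4 b5 b6 b7))))))))).

Lemma all_boolP P : all_bool P -> forall b, P b.
Proof. by case/andP=> Pf Pt []. Qed.

Lemma all_truth_tablesP P g : all_truth_tables P ->
  exists2 h, (forall a b c, g a b c = h a b c) & P h.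
Proof.
move=> /all_boolP/(_ (g false false false))/all_boolP/(_ (g false false true)).
move=> /all_boolP/(_ (g false true false))/all_boolP/(_ (g false true true)).
move=> /all_boolP/(_ (g true false false))/all_boolP/(_ (g true false true)).
move=> /all_boolP/(_ (g true true false))/all_boolP/(_ (g true true true)) Ph.
by eexists; last exact: Ph; move=> [] [] [].
Qed.

Definition certified g : bool :=
  let V := min_lazy g in essential g ==> certificate g V (attained_states g V).

(** All 256 tables are evaluated. The outputs of [min_lazy] and [attained_states] are validated by
    [certificate] itself. *)
Lemma all_truth_tables_certified : all_truth_tables certified.
Proof. by vm_compute. Qed.

Lemma certificate_exists g : essential g ->
  exists h V E, (forall a b c, g a b c = h a b c) /\ certificate h V E.
Proof.
move=> ge; have [h gh] := all_truth_tablesP g all_truth_tables_certified.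
have he : essential h by move: ge; rewrite /essential /has_bool !gh.
rewrite /certified he; exists h, (min_lazy h), (attained_states h (min_lazy h)).
by [].
Qed.

(** * Projection of positions to classes *)

Definition ord3_0 : 'I_3 := Ordinal (isT : 0 < 3).
Definition ord3_1 : 'I_3 := Ordinal (isT : 1 < 3).
Definition ord3_2 : 'I_3 := Ordinal (isT : 2 < 3).

Lemma ord3P (P : 'I_3 -> Prop) : P ord3_0 -> P ord3_1 -> P ord3_2 -> forall k, P k.
Proof.
move=> P0 P1 P2 [[|[|[|//]]] lt3].
- by rewrite (_ : Ordinal lt3 = ord3_0) //; apply: val_inj.
- by rewrite (_ : Ordinal lt3 = ord3_1) //; apply: val_inj.
- by rewrite (_ : Ordinal lt3 = ord3_2) //; apply: val_inj.
Qed.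

Definition state_of (d : position 3) : state :=
  (sat (d ord3_0), sat (d ord3_1), sat (d ord3_2)).

Lemma sat_lt4 m : sat m < 4.
Proof. by elim: m => //= m; case: (sat m) => [|[|[|[]]]]. Qed.

Lemma odd_sat m : odd (sat m) = odd m.
Proof.
elim: m => //= m <-; have := sat_lt4 m.
by case: (sat m) => [|[|[|[|]]]].
Qed.

Lemma sat_eq0 m : (sat m == 0) = (m == 0).
Proof. by case: m => //= m; case: (sat m) => [|[|[|[]]]]. Qed.

Lemma sat_mem_pred m : sat m \in sat_pred (sat m.+1).
Proof.
rewrite /=; have := sat_lt4 m.
by case: (sat m) => [|[|[|[|]]]].
Qed.

Lemma sat_pred_neq0 m : sat_pred (sat m) != [::] -> 0 < m.
Proof. by case: m. Qed.

Lemma sat_reduce m : 0 < m -> sat (if odd m then 1 else 2) = reduce (sat m).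
Proof. by rewrite /reduce odd_sat; case: odd. Qed.

Lemma state_of_mem d : state_of d \in states.
Proof.
rewrite /state_of; move: (sat_lt4 (d ord3_0)) (sat_lt4 (d ord3_1)) (sat_lt4 (d ord3_2)).
by do 3![case: (sat _) => [|[|[|[|//]]]]].
Qed.

Lemma state_of_step d k :
  state_of d \in flatten (state_preds (state_of (step d k))).
Proof.
apply/flattenP; move: k; apply: ord3P;
  rewrite /state_of /state_preds !ffunE /= ?addn0 addn1.
- exists [seq (t, sat (d ord3_1), sat (d ord3_2)) | t <- sat_pred (sat (d ord3_0).+1)].
    by rewrite inE eqxx.
  by apply: map_f; apply: sat_mem_pred.
- exists [seq (sat (d ord3_0), t, sat (d ord3_2)) | t <- sat_pred (sat (d ord3_1).+1)].
    by rewrite !inE eqxx orbT.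
  by apply: map_f; apply: sat_mem_pred.
- exists [seq (sat (d ord3_0), sat (d ord3_1), t) | t <- sat_pred (sat (d ord3_2).+1)].
    by rewrite !inE eqxx !orbT.
  by apply: map_f; apply: sat_mem_pred.
Qed.

(** A nonempty list forces a positive coordinate, since class 0 has no predecessor. Which class of
    [l] occurs depends on [d], hence the [all] in [attained]. *)
Lemma state_preds_of d l :
  l \in state_preds (state_of d) -> l != [::] ->
  exists k e, d = step e k /\ state_of e \in l.
Proof.
have predP k : 0 < d k -> exists e : position 3,
    [/\ d = step e k, d k = (e k).+1 & forall j, j != k -> e j = d j].
  move=> dk; exists [ffun i => d i - (i == k)]; split.
  - apply/ffunP=> i; rewrite !ffunE.
    by case: eqP => [->|_]; rewrite ?subnK ?subn0 ?addn0.
  - by rewrite ffunE eqxx subn1 prednK.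
  - by move=> j /negPf jk; rewrite ffunE jk subn0.
have mapN0 (T : eqType) (h : nat -> T) s : map h s != [::] -> s != [::] by case: s.
rewrite !inE => /or3P[] /eqP-> /mapN0/sat_pred_neq0/predP[e [dE dk ed]].
- exists ord3_0, e; split=> //; rewrite /state_of dk -(ed ord3_1) // -(ed ord3_2) //.
  by apply: map_f; apply: sat_mem_pred.
- exists ord3_1, e; split=> //; rewrite /state_of dk -(ed ord3_0) // -(ed ord3_2) //.
  by apply: map_f; apply: sat_mem_pred.
- exists ord3_2, e; split=> //; rewrite /state_of dk -(ed ord3_0) // -(ed ord3_1) //.
  by apply: map_f; apply: sat_mem_pred.
Qed.

(** The potential is pulled back along [state_of]: [sat] preserves parity, hence lazy steps, and
    each step projects to an arc of the quotient graph. *)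
Lemma cost_certificate f x g V E : transientv x ->
  (forall d, position_label f x d =
     g (odd (d ord3_0)) (odd (d ord3_1)) (odd (d ord3_2))) ->
  certificate g V E -> E (state_of (displacement x)) ->
  cost f x = (V (state_of (displacement x)))%:Z%R.
Proof.
move=> xT labelE /and4P[/eqP V0 /allP lower /allP upper _].
have lazyE d e : lazy_step f x d e = state_lazy g (state_of d) (state_of e).
  by rewrite /lazy_step !labelE /state_lazy /= !odd_sat.
apply: (@cost_potential _ f x (V \o state_of) (E \o state_of)) => //=.
- by rewrite /state_of !ffunE.
- move=> d k; rewrite lazyE; apply: (allP (lower _ (state_of_mem _))).
  exact: state_of_step.
- move=> d Ed; have := upper _ (state_of_mem d); rewrite Ed /= => /orP[/eqP d0|].
    (* The class of the origin contains no other position. *)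
    left; apply/ffunP; move: d0 => [/eqP + /eqP + /eqP]; rewrite !sat_eq0.
    by move=> /eqP d0 /eqP d1 /eqP d2; apply: ord3P; rewrite ffunE.
  case/hasP=> l /state_preds_of h.
  case/andP=> /h[k [e [dE el]]] /allP/(_ _ el)/andP[Ee le].
  by right; exists k, e; rewrite lazyE.
Qed.

(** * Translation by the first letters, and the theorem *)

Definition shifted_label (f : bvec 3 -> bool) (s : bvec 3) (a b c : bool) : bool :=
  f [ffun i : 'I_3 => s i (+) nth false [:: a; b; c] i].

(** Translation by [s] is an involution acting on each coordinate separately, so it preserves
    dependence on each argument. *)
Lemma shifted_label_essential f s : depends_on_all f -> essential (shifted_label f s).
Proof.
move=> fdep; have has_boolP (P : pred bool) b : P b -> has_bool P.
  by rewrite /has_bool; case: b => ->; rewrite ?orbT.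
pose u (a : bvec 3) i := s i (+) a i.
have fE a : f a = shifted_label f s (u a ord3_0) (u a ord3_1) (u a ord3_2).
  by congr f; apply/ffunP; apply: ord3P; rewrite ffunE /= /u addbA addbb.
have dep k : exists a b, (forall j, j != k -> u a j = u b j) /\
   shifted_label f s (u a ord3_0) (u a ord3_1) (u a ord3_2) !=
   shifted_label f s (u b ord3_0) (u b ord3_1) (u b ord3_2).
  have [a [b [ab /eqP fab]]] := fdep k; exists a, b; rewrite -!fE; split=> //.
  by move=> j /ab; rewrite /u => ->.
apply/and3P; split.
- have [a [b [ab]]] := dep ord3_0; rewrite (ab ord3_1) // (ab ord3_2) //.
  move=> ne; apply: (has_boolP _ (u b ord3_1)); apply: (has_boolP _ (u b ord3_2)).
  (* Equal values at the remaining coordinate contradict [ne]; otherwise they are [false] and [true]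
     in some order. *)
  by move: ne => /=; case: (u a _); case: (u b ord3_0); rewrite ?eqxx // 1?eq_sym.
- have [a [b [ab]]] := dep ord3_1; rewrite (ab ord3_0) // (ab ord3_2) //.
  move=> ne; apply: (has_boolP _ (u b ord3_0)); apply: (has_boolP _ (u b ord3_2)).
  by move: ne => /=; case: (u a _); case: (u b ord3_1); rewrite ?eqxx // 1?eq_sym.
- have [a [b [ab]]] := dep ord3_2; rewrite (ab ord3_0) // (ab ord3_1) //.
  move=> ne; apply: (has_boolP _ (u b ord3_0)); apply: (has_boolP _ (u b ord3_1)).
  by move: ne => /=; case: (u a _); case: (u b ord3_2); rewrite ?eqxx // 1?eq_sym.
Qed.

Lemma alpha_ctrans t : alpha (ctrans t) = alpha t.
Proof. by rewrite /ctrans; case: t => //= a s; case: ifP. Qed.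

Lemma Delta_ctrans t :
  0 < Delta t -> Delta (ctrans t) = if odd (Delta t) then 1 else 2.
Proof.
rewrite /ctrans /Delta; case: t => [|a [|b [|c s]]] //= _.
by case: (odd (size s)); rewrite /= ?take0.
Qed.

Theorem theorem3 (f : bvec 3 -> bool) (hf : depends_on_all f) : convenient f.
Proof.
split=> // x /andP[xT /forallP xD].
pose s : bvec 3 := [ffun i => alpha (x i)].
have [h [V [E [gh cert]]]] := certificate_exists (shifted_label_essential s hf).
have yT : transientv (ctransv x).
  by apply/forallP=> i; rewrite ffunE; apply/ctrans_transient/(forallP xT).
(* The shift absorbs the first letters, so a single certificate serves both [x] and [ctransv x]. *)
have labelE (z : wvec 3) : (forall i, alpha (z i) = alpha (x i)) ->
    forall d, position_label f z d =
      h (odd (d ord3_0)) (odd (d ord3_1)) (odd (d ord3_2)).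
  move=> zx d; rewrite -gh; congr f.
  by apply/ffunP; apply: ord3P; rewrite !ffunE zx.
have inner (z : wvec 3) : (forall i, 0 < Delta (z i)) ->
    E (state_of (displacement z)) /\
    V (state_of (displacement z)) = V (state_of (displacement (ctransv z))).
  move=> zD; have /and4P[_ _ _ /allP/(_ _ (state_of_mem (displacement z)))] := cert.
  rewrite /state_of !ffunE !lt0n !sat_eq0 -!lt0n !zD.
  by rewrite !Delta_ctrans // !sat_reduce // => /andP[-> /eqP].
have [Ex Vx] := inner x xD.
have yD i : 0 < Delta (ctransv x i) by rewrite ffunE Delta_ctrans //; case: odd.
have [Ey _] := inner _ yD.
rewrite (cost_certificate xT (labelE x _) cert Ex) // Vx.
rewrite (cost_certificate yT (labelE _ _) cert Ey) // => i.
by rewrite ffunE alpha_ctrans.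
Qed.
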